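(* Let $G$ be a finite group with center $Z(G)$ such that $G/Z(G)\cong Sz(2)$, the Suzuki group of order $20$, and let $n=|Z(G)|$. Let $\Gamma_G$ be the non-commuting graph of $G$. Then: (a) The adjacency spectrum of $\Gamma_G$ is $\left\{(0)^{19n-6},\ (-3n)^4,\ \left(2n(3+2\sqrt6)\right)^1,\ \left(2n(3-2\sqrt6)\right)^1\right\}$ and $E(\Gamma_G)=4n(3+2\sqrt6)$. (b) The signless Laplacian spectrum of $\Gamma_G$ is $\left\{(16n)^{15n-5},\ (15n)^{4n-1},\ (13n)^4,\ \left(\tfrac{n(43+\sqrt{409})}{2}\right)^1,\ \left(\tfrac{n(43-\sqrt{409})}{2}\right)^1\right\}$ and $LE^+(\Gamma_G)=\frac{120n^2+177n}{19}+\sqrt{409}\,n$.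
   Context: $Sz(2)$ is the group of order $20$ with presentation $\langle a,b : a^5=b^4=1,\ b^{-1}ab=a^2\rangle$. For a finite non-abelian group $G$ with center $Z(G)$, the non-commuting graph $\Gamma_G$ is the simple undirected graph with vertex set $G\setminus Z(G)$ in which $x,y$ are adjacent iff $xy\ne yx$. For a finite simple graph $\mathcal G$ with vertex set $v(\mathcal G)$, edge set $e(\mathcal G)$, adjacency matrix $A(\mathcal G)$ and diagonal degree matrix $D(\mathcal G)$, the adjacency spectrum is the multiset of eigenvalues of $A(\mathcal G)$ and the signless Laplacian spectrum is the multiset of eigenvalues of $Q(\mathcal G)=D(\mathcal G)+A(\mathcal G)$. The notation $\{(\gamma_1)^{d_1},\dots,(\gamma_l)^{d_l}\}$ means the multiset in which $\gamma_r$ is listed $d_r$ times. With sums over spectra counted with multiplicity, $E(\mathcal G)=\sum_\lambda|\lambda|$ over the adjacency spectrum and $LE^+(\mathcal G)=\sum_{\gamma}\left|\gamma-\frac{2|e(\mathcal G)|}{|v(\mathcal G)|}\right|$ over the signless Laplacian spectrum. *)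

(* Defs.v *)
From HB Require Import structures.
From mathcomp Require Import all_boot all_order all_fingroup all_solvable.
From mathcomp Require Import all_algebra all_field.

Set Implicit Arguments.
Unset Strict Implicit.
Unset Printing Implicit Defensive.

Import Order.TTheory GRing.Theory Num.Theory.
Local Open Scope ring_scope.

Record sgraph := SGraph {
  vertex : finType;
  adj : rel vertex;
  adj_sym : symmetric adj;
  adj_irr : irreflexive adj
}.

Definition edges (X : sgraph) : {set {set vertex X}} :=
  [set [set x; y] | x in [set: vertex X], y in [set y | adj x y]].

Definition degree (X : sgraph) (x : vertex X) : nat := #|[set y | adj x y]|.

(* Matrices of a graph are indexed through the enumeration of its vertices. *)
Definition adjacency_mx (C : nzRingType) (X : sgraph) : 'M[C]_#|vertex X| :=
  \matrix_(i, j) (adj (enum_val i) (enum_val j))%:R.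

Definition degree_mx (C : nzRingType) (X : sgraph) : 'M[C]_#|vertex X| :=
  diag_mx (\row_i (degree (enum_val i))%:R).

Definition signless_laplacian_mx (C : nzRingType) (X : sgraph) :
  'M[C]_#|vertex X| := degree_mx C X + adjacency_mx C X.

(* Eigenvalues counted with (algebraic) multiplicity, in an arbitrary order:
   such sequences are only meaningful up to perm_eq. *)
Definition eigenvalues (C : closedFieldType) (m : nat) (M : 'M[C]_m) : seq C :=
  sval (closed_field_poly_normal (char_poly M)).

Lemma eigenvaluesP (C : closedFieldType) (m : nat) (M : 'M[C]_m) :
  char_poly M = \prod_(z <- eigenvalues M) ('X - z%:P).
Proof.
rewrite /eigenvalues; case: closed_field_poly_normal => r /= {1}->.
by rewrite (monicP (char_poly_monic M)) scale1r.
Qed.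

Definition adjacency_spectrum (C : closedFieldType) (X : sgraph) : seq C :=
  eigenvalues (adjacency_mx C X).

Definition signless_laplacian_spectrum (C : closedFieldType) (X : sgraph) :
  seq C := eigenvalues (signless_laplacian_mx C X).

Definition energy (C : numClosedFieldType) (X : sgraph) : C :=
  \sum_(z <- adjacency_spectrum C X) `|z|.

Definition signless_laplacian_energy (C : numClosedFieldType) (X : sgraph) : C :=
  \sum_(z <- signless_laplacian_spectrum C X)
    `|z - (2 * #|edges X|)%:R / #|vertex X|%:R|.

Section NonCommutingGraph.

Variables (gT : finGroupType) (G : {group gT}).

Definition noncentral : finType := {x : gT | x \in G :\: 'Z(G)%g}.

Definition noncommuting : rel noncentral :=
  fun x y => (val x * val y != val y * val x)%g.

Lemma noncommuting_sym : symmetric noncommuting.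
Proof. by move=> x y; rewrite /noncommuting eq_sym. Qed.

Lemma noncommuting_irr : irreflexive noncommuting.
Proof. by move=> x; rewrite /noncommuting eqxx. Qed.

Definition noncommuting_graph : sgraph :=
  SGraph noncommuting_sym noncommuting_irr.

End NonCommutingGraph.

(* In MathComp, a ^ b is the conjugate b^-1 * a * b. As the abstract group
   given by this presentation is finite (of order 20), "\isog Grp" really is
   isomorphism with it. *)
Definition is_Sz2 (gT : finGroupType) (H : {set gT}) : Prop :=
  (H \isog Grp (a : b : a ^+ 5 = 1, b ^+ 4 = 1, a ^ b = a ^+ 2))%g.

(* Main.v *)
Require Import Defs.
From HB Require Import structures.
From mathcomp Require Import all_boot all_order all_fingroup all_solvable.
From mathcomp Require Import all_algebra all_field.
From mathcomp Require Import ring zify.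

(* The quotient G / Z(G) is a Frobenius group with cyclic kernel of order 5 and
   cyclic complements of order 4.  Noncentral elements of G commute exactly when
   their images lie in the same member of the Frobenius partition, so the
   non-commuting graph is complete multipartite, with one part of size 4n and
   five parts of size 3n.  Up to a diagonal matrix that is constant on parts, its
   matrices factor through the set of parts, and det(1 - AB) = det(1 - BA) turns
   the characteristic polynomial into a product of linear factors and one
   quadratic. *)

Set Implicit Arguments.
Unset Strict Implicit.
Unset Printing Implicit Defensive.

Import Order.TTheory GRing.Theory Num.Theory.
Local Open Scope ring_scope.

(** * Determinants, and polynomial identities tested by evaluation *)

(** The block matrix with rows [1, A] and [B, 1] factors into block triangular matrices in two ways,
    one for each side. *)
Lemma det_1subM_comm (R : comNzRingType) (m k : nat)
    (A : 'M[R]_(m, k)) (B : 'M[R]_(k, m)) :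
  \det (1%:M - A *m B) = \det (1%:M - B *m A).
Proof.
pose M := block_mx 1%:M A B 1%:M : 'M_(m + k).
have lower : M = block_mx 1%:M 0 B 1%:M *m block_mx 1%:M A 0 (1%:M - B *m A).
  by rewrite mulmx_block !mul1mx !mul0mx !mulmx1 ?mulmx0 !addr0 addrC subrK.
have upper : M = block_mx (1%:M - A *m B) A 0 1%:M *m block_mx 1%:M 0 B 1%:M.
  by rewrite mulmx_block !mul1mx !mul0mx !mulmx1 ?mulmx0 !add0r subrK.
have: \det M = \det M by [].
rewrite {1}upper lower !det_mulmx !det_ublock !det_lblock !det1.
by rewrite !mul1r !mulr1.
Qed.

(** This lets a characteristic polynomial be computed only where no denominator vanishes.
    Multiplying [p - q] by the polynomial with roots [s] gives a polynomial that vanishes on all of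
    [F], which is infinite. *)
Lemma poly_eq_off_seq (F : numFieldType) (s : seq F) (p q : {poly F}) :
  (forall x, x \notin s -> p.[x] = q.[x]) -> p = q.
Proof.
move=> eq_pq; apply/eqP; rewrite -subr_eq0.
have nz : \prod_(z <- s) ('X - z%:P) != 0 :> {poly F}.
  by rewrite monic_neq0 // monic_prod_XsubC.
suff: (p - q) * \prod_(z <- s) ('X - z%:P) == 0.
  by rewrite mulf_eq0 (negPf nz) orbF.
set r := _ * _; apply/negPn/negP => nz_r.
(* These are [size r] distinct roots of [r], one more than its degree allows. *)
pose rs := [seq i%:R : F | i <- iota 0 (size r)].
have := max_poly_roots nz_r (rs := rs); rewrite size_map size_iota ltnn.
move=> contra; apply/notF/contra; last first.
  by rewrite map_inj_uniq ?iota_uniq //; apply: mulrIn; rewrite oner_eq0.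
apply/allP => x _; rewrite rootE hornerM hornerD hornerN.
have [xs | /eq_pq->] := boolP (x \in s); last by rewrite subrr mul0r.
by have := xs; rewrite -root_prod_XsubC rootE => /eqP->; rewrite mulr0.
Qed.

(** * Determinant of a matrix with complete multipartite pattern *)

Section CompleteMultipartite.

Variables (F : fieldType) (m : nat) (T : finType) (col : 'I_m -> T).

Local Notation part t := #|[set i | col i == t]|.

(* Modulo the diagonal, the matrix factors through the colours as
   [U (J - 1) U^T], which reduces the determinant to one indexed by colours;
   there it is a rank one perturbation of a diagonal matrix. *)
Lemma det_multipartite (e : T -> F) :
    (forall t, e t != 0) -> (forall t, e t + (part t)%:R != 0) ->
  \det (\matrix_(i, j) ((i == j)%:R * e (col i) - (col i != col j)%:R)) =
    \prod_t (e t ^+ part t * (1 + (part t)%:R / e t))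
    * (1 - \sum_t (part t)%:R / (e t + (part t)%:R)).
Proof.
move=> nz_e nz_ep; pose k := #|T|.
pose U : 'M[F]_(m, k) := \matrix_(i, t) (col i == enum_val t)%:R.
pose L : 'rV[F]_m := \row_i e (col i).
pose L' : 'rV[F]_m := \row_i (e (col i))^-1.
pose W : 'M[F]_k := const_mx 1 - 1%:M.
pose c : 'rV[F]_k := \row_t ((part (enum_val t))%:R / e (enum_val t)).
pose c1 : 'rV[F]_k := \row_t (1 + c 0 t).
pose v : 'cV[F]_k := \col_t (c 0 t / c1 0 t).
have nz_c1 t : c1 0 t != 0.
  have ->: c1 0 t = (e (enum_val t) + (part (enum_val t))%:R) / e (enum_val t).
    by rewrite !mxE; field; apply: nz_e.
  by rewrite mulf_neq0 ?invr_eq0.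
have UWU i j : (U *m W *m U^T) i j = (col i != col j)%:R.
  have UE (A : 'M[F]_(k, m)) i' j' : (U *m A) i' j' = A (enum_rank (col i')) j'.
    rewrite mxE (bigD1 (enum_rank (col i'))) //= mxE enum_rankK eqxx mul1r.
    rewrite big1 ?addr0 // => t nt; rewrite mxE.
    by rewrite -(can2_eq (@enum_rankK _) (@enum_valK _)) eq_sym (negPf nt) mul0r.
  rewrite -mulmxA UE mxE (bigD1 (enum_rank (col j))) //= big1 => [|t nt].
    rewrite !mxE enum_rankK eqxx mulr1 addr0 (inj_eq enum_rank_inj).
    by case: eqP; rewrite ?subrr ?subr0.
  rewrite [U^T _ _]mxE [U _ _]mxE.
  by rewrite -(can2_eq (@enum_rankK _) (@enum_valK _)) eq_sym (negPf nt) mulr0.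
have LL' : diag_mx L *m diag_mx L' = 1%:M.
  rewrite mulmx_diag; apply/matrixP=> i j; rewrite !mxE.
  by case: eqP => // _; rewrite divff.
have -> : \matrix_(i, j) ((i == j)%:R * e (col i) - (col i != col j)%:R) =
          diag_mx L *m (1%:M - diag_mx L' *m U *m W *m U^T).
  rewrite mulmxBr mulmx1 !mulmxA LL' mul1mx.
  apply/matrixP=> i j.
  have entryB (A B : 'M[F]_m) : (A - B) i j = A i j - B i j by rewrite !mxE.
  rewrite entryB UWU !mxE.
  by case: eqP; rewrite ?mulr1n ?mulr0n ?mul1r ?mul0r.
rewrite det_mulmx det_1subM_comm.
have -> : U^T *m (diag_mx L' *m U *m W) = diag_mx c *m W.
  rewrite !mulmxA; congr (_ *m _); apply/matrixP=> s t; rewrite !mxE.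
  transitivity (\sum_(i | col i == enum_val s)
                  (s == t)%:R / e (enum_val s)).
    rewrite [RHS]big_mkcond; apply: eq_bigr => i _.
    rewrite mxE (bigD1 i) //= !mxE big1 ?addr0 => [|j nj]; last first.
      by rewrite !mxE (negPf nj) mulr0.
    rewrite eqxx mulr1n; case: eqP => [->|_]; last by rewrite !mul0r.
    by rewrite (inj_eq enum_val_inj) mul1r mulrC.
  rewrite sumr_const -[LHS]mulr_natl cardsE mulrCA mulr_natl.
  by rewrite mulr_natl.
(* Since [W] is the all-ones matrix minus 1, the left side is [diag_mx c1] minus the rank one matrix
   with column [c] and row of ones. Pulling out [diag_mx c1] turns the column into [v], and a second
   use of [det_1subM_comm] leaves a 1 by 1 determinant. *)
have -> : 1%:M - diag_mx c *m W =
          diag_mx c1 *m (1%:M - v *m (const_mx 1 : 'rV_k)).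
  rewrite !mulmxBr !mulmx1 opprB addrCA mulmxA.
  have Dc1 : diag_mx c1 = diag_mx c + 1%:M.
    by apply/matrixP=> s t; rewrite !mxE addrC -mulrnDl.
  have D1v : diag_mx c1 *m v = c^T.
    apply/matrixP=> s t; rewrite (ord1 t) mul_diag_mx [LHS]mxE [v _ _]mxE.
    by rewrite [RHS]mxE mulrCA divff // mulr1.
  rewrite Dc1 -addrA -Dc1 D1v; congr (_ + (_ - _)).
  by apply/matrixP=> s t; rewrite mul_diag_mx !mxE big_ord1 !mxE.
rewrite det_mulmx det_1subM_comm !det_diag det_mx11 mulrA; congr (_ * _).
  rewrite big_split /=; congr (_ * _).
    rewrite (partition_big col xpredT) //=; apply: eq_bigr => t _.
    rewrite (eq_bigr (fun=> e t)) => [|i /eqP<-]; last by rewrite mxE.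
    by rewrite prodr_const cardsE.
  rewrite (reindex_onto (@enum_val T predT) enum_rank) /= => [|t _]; last first.
    by rewrite enum_rankK.
  apply: eq_big => t; first by rewrite enum_valK eqxx.
  by rewrite !mxE.
rewrite !mxE; congr (_ - _).
rewrite [RHS](reindex_onto (@enum_val T predT) enum_rank) /= => [|t _]; last first.
  by rewrite enum_rankK.
apply: eq_big => t; first by rewrite enum_valK eqxx.
move=> _; rewrite !mxE mul1r.
by field; rewrite nz_ep nz_e.
Qed.

End CompleteMultipartite.

Lemma char_poly_horner (F : fieldType) (m : nat) (M : 'M[F]_m) (x : F) :
  (char_poly M).[x] = \det (x%:M - M).
Proof.
rewrite -[LHS]/(horner_eval x (char_poly M)) -det_map_mx; congr (\det _).
apply/matrixP=> i j; rewrite !mxE rmorphB rmorphMn /=.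
by rewrite /horner_eval hornerX hornerC.
Qed.

(** Double counting of pairs formed by an edge and one of its ends; irreflexivity of [adj] makes
    each edge a set of exactly two vertices. *)
Lemma sum_degree (X : sgraph) :
  (\sum_(x : vertex X) degree x = 2 * #|edges X|)%N.
Proof.
have edge_card E : E \in edges X -> #|E| = 2.
  case/imset2P=> x y _; rewrite inE => xy ->; rewrite cards2.
  by case: eqP xy => // ->; rewrite adj_irr.
transitivity (\sum_(x : vertex X) #|[set E in edges X | x \in E]|)%N.
  apply: eq_bigr => x _; rewrite /degree.
  have inj : {in [set y | adj x y] &, injective (fun y => [set x; y])}.
    move=> y z; rewrite !inE => xy xz /setP/(_ y); rewrite !inE eqxx orbT.
    by case: eqP xy => [->|_ _ /esym/eqP //]; rewrite adj_irr.
  rewrite -(card_in_imset inj); apply: eq_card => E.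
  apply/imsetP/idP => [[y xy ->]|].
    by rewrite inE set21 andbT; apply/imset2P; exists x y; rewrite ?inE // in xy *.
  rewrite inE => /andP[/imset2P[y z _ yz ->]]; rewrite inE in yz.
  rewrite !inE => /orP[] /eqP->; first by exists z; rewrite ?inE.
  by exists y; rewrite ?inE 1?adj_sym // setUC.
transitivity (\sum_(E in edges X) #|E|)%N; last first.
  by rewrite (eq_bigr (fun=> 2)) ?sum_nat_const 1?mulnC.
under eq_bigr do rewrite -sum1dep_card; under [RHS]eq_bigr do rewrite -sum1_card.
rewrite (exchange_big_dep (mem (edges X))) => [|x E _ /andP[] //].
apply: eq_bigr => E XE; apply: eq_bigl => x.
by rewrite [E \in _]XE.
Qed.

(** * Complete multipartite graphs with one part of size [q] and the others of size [s] *)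

Section TwoPartSizes.

Variables (C : numClosedFieldType) (X : sgraph) (T : finType).
Variables (col : vertex X -> T) (t0 : T) (S : {set T}) (q s : nat).
Hypothesis adj_col : forall x y, adj x y = (col x != col y).
Hypothesis t0S : t0 \notin S.
Hypothesis S_gt0 : (0 < #|S|)%N.
Hypothesis q_gt0 : (0 < q)%N.
Hypothesis s_gt0 : (0 < s)%N.
Hypothesis part_t0 : #|[set x | col x == t0]| = q.
Hypothesis part_S : forall t, t \in S -> #|[set x | col x == t]| = s.
Hypothesis part_rest :
  forall t, t != t0 -> t \notin S -> #|[set x | col x == t]| = 0%N.

(** Colours other than [t0] and those in [S] have empty parts, and the condition on [f 0] makes them
    neutral. The operation is kept abstract to serve both sums and products. *)
Lemma big_part (R : Type) (idx : R) (op : Monoid.com_law idx)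
    (f : nat -> T -> R) :
    (forall t, f 0%N t = idx) ->
  \big[op/idx]_t f #|[set x | col x == t]| t =
  op (f q t0) (\big[op/idx]_(t in S) f s t).
Proof.
move=> f0; rewrite (bigD1 t0) //= part_t0; congr (op _ _).
rewrite (bigID (mem S)) /= [X in op _ X]big1 => [|t /andP[nt tS]]; last first.
  by rewrite part_rest.
rewrite Monoid.mulm1; apply: eq_big => [t|t /andP[_ /part_S-> //]].
by case: eqP => // ->; rewrite (negPf t0S).
Qed.

Lemma card_vertex : #|vertex X| = (q + #|S| * s)%N.
Proof.
transitivity (\sum_(x : vertex X) 1)%N; first by rewrite sum1_card.
rewrite (partition_big col xpredT) //=.
rewrite (eq_bigr (fun t => #|[set x | col x == t]|)) => [|t _]; last first.
  by rewrite sum1dep_card.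
by rewrite (@big_part _ _ _ (fun k _ => k)) // sum_nat_const.
Qed.

Lemma degree_col x : degree x = (#|vertex X| - #|[set y | col y == col x]|)%N.
Proof.
rewrite /degree cardsCs; congr (_ - _)%N; apply: eq_card => y.
by rewrite !inE adj_col negbK eq_sym.
Qed.

Lemma double_edges :
  (2 * #|edges X| = q * (#|S| * s) + #|S| * s * (q + #|S| * s - s))%N.
Proof.
rewrite -sum_degree (partition_big col xpredT) //=.
pose f k (_ : T) := (k * (#|vertex X| - k))%N.
rewrite (eq_bigr (fun t => f #|[set x | col x == t]| t)) => [|t _]; last first.
  rewrite (eq_bigr (fun=> #|vertex X| - #|[set x | col x == t]|))%N.
    by rewrite sum_nat_const cardsE.
  by move=> x /eqP<-; rewrite degree_col.
by rewrite big_part // sum_nat_const /f card_vertex addKn !mulnA.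
Qed.

(** The weight [w] is 0 for the adjacency matrix and the degree for the signless Laplacian. The left
    side of the quadratic hypothesis is [1 - q / (x - a + q) - #|S| * s / (x - b + s)] with
    denominators cleared. *)
Lemma eigenvalues_multipartite (a b u v : C) (w : vertex X -> C) :
    (forall x, w x = if col x == t0 then a else b) ->
    (forall x, (x - a) * (x - b + s%:R) - (#|S| * s)%:R * (x - a + q%:R) =
               (x - u) * (x - v)) ->
  perm_eq (eigenvalues (diag_mx (\row_i w (enum_val i)) + adjacency_mx C X))
    (nseq q.-1 a ++ nseq (#|S| * s.-1) b ++ nseq #|S|.-1 (b - s%:R)
     ++ [:: u; v]).
Proof.
move=> wE quad; set M := _ + _; apply: prod_XsubC_eq.
rewrite -eigenvaluesP.
(* The excluded points are the zeros of [e t] and of [e t] plus the part size, for the three kinds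
   of part. *)
apply: (@poly_eq_off_seq _ [:: a; b; a - q%:R; b - s%:R]) => x.
rewrite !inE !negb_or => /and4P[xa xb xq xs].
have ea t : x - (if t == t0 then a else b) != 0.
  by case: ifP => _; rewrite subr_eq0.
pose colI (i : 'I_#|vertex X|) := col (enum_val i).
have partE t : #|[set i | colI i == t]| = #|[set y | col y == t]|.
  have inj : injective (fun i : 'I_#|vertex X| => enum_val i).
    exact: enum_val_inj.
  rewrite -[LHS](card_imset (mem [set i | colI i == t]) inj).
  apply: eq_card => y.
  apply/imsetP/idP => [[i]|]; rewrite !inE; first by move=> ? ->.
  by exists (enum_rank y); rewrite ?inE /colI enum_rankK.
have shift (c d : C) : x - c + d = x - (c - d) by ring.
have eaq t : x - (if t == t0 then a else b) +
    #|[set i | colI i == t]|%:R != 0.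
  rewrite partE; have [->|nt] := eqVneq t t0.
    by rewrite part_t0 shift subr_eq0.
  have [/part_S->|tS] := boolP (t \in S); first by rewrite shift subr_eq0.
  by rewrite part_rest // addr0 subr_eq0.
transitivity (\det (\matrix_(i, j)
    ((i == j)%:R * (x - (if colI i == t0 then a else b))
      - (colI i != colI j)%:R)) : C).
  rewrite char_poly_horner; congr (\det _); apply/matrixP=> i j; rewrite !mxE.
  rewrite adj_col wE opprD addrA; congr (_ - _).
  by rewrite mulr_natl mulrnBl.
rewrite (det_multipartite (e := fun t => x - (if t == t0 then a else b))) //.
have St0 t : t \in S -> t != t0 by apply: contraTneq => ->.
pose e t := x - (if t == t0 then a else b).
pose f (k : nat) t : C := e t ^+ k * (1 + k%:R / e t).
pose g (k : nat) t : C := k%:R / (e t + k%:R).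
transitivity (\prod_t f #|[set y | col y == t]| t
              * (1 - \sum_t g #|[set y | col y == t]| t)).
  by congr (_ * (1 - _)); apply: eq_bigr => t _; rewrite partE.
rewrite !big_part => [|t|t]; last by rewrite /f expr0 mul0r addr0 mulr1.
  have -> : \prod_(t in S) f s t =
      ((x - b) ^+ s * (1 + s%:R / (x - b))) ^+ #|S|.
    by rewrite -prodr_const; apply: eq_bigr => t /St0/negPf nt; rewrite /f /e nt.
  have -> : \sum_(t in S) g s t = #|S|%:R * (s%:R / (x - b + s%:R)).
    rewrite mulr_natl -sumr_const.
    by apply: eq_bigr => t /St0/negPf nt; rewrite /g /e nt.
  rewrite /f /g /e eqxx.
  rewrite !big_cat !big_cons big_nil !big_nseq /= !iter_mulr_1 mulr1.
  rewrite !hornerM !horner_exp !hornerXsubC -quad.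
  have xaq : x - a + q%:R != 0 by rewrite shift subr_eq0.
  have xbs : x - b + s%:R != 0 by rewrite shift subr_eq0.
  move: xa xb xaq xbs; rewrite -(subr_eq0 x a) -(subr_eq0 x b) -shift.
  move: (x - a) (x - b) => A B nzA nzB nzAq nzBs.
  (* One factor is split off because [A ^+ q * (1 + q / A)] is [A ^+ q.-1 * (A + q)], and similarly
     for [B]. The factor [A + q] and a single [B + s] then clear the denominators of the remaining
     sum. *)
  have -> : A ^+ q = A * A ^+ q.-1 by rewrite -exprS prednK.
  have -> : (B ^+ s * (1 + s%:R / B)) ^+ #|S| =
      B ^+ (#|S| * s.-1) * ((B + s%:R) * (B + s%:R) ^+ #|S|.-1).
    rewrite -exprS prednK // mulnC exprM -exprMn; congr (_ ^+ _).
    have -> : B ^+ s = B * B ^+ s.-1 by rewrite -exprS prednK.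
    by field.
  by rewrite natrM; field; rewrite nzA nzAq nzBs.
by rewrite /g mul0r.
Qed.

End TwoPartSizes.

(** * The group Sz(2) as a Frobenius group *)

Section Sz2.

Local Open Scope nat_scope.
Local Open Scope group_scope.

(* The translation i |-> 1 + i and the dilation i |-> 2 i of F_5 satisfy the
   presentation, so the presented group does not collapse below order 20. *)
Lemma Sz2_model :
  exists2 K : {group {perm 'F_5}},
    K \homg Grp (a : b : a ^+ 5 = 1, b ^+ 4 = 1, a ^ b = a ^+ 2) &
    20 %| #|K|.
Proof.
have nz2 : (2%:R : 'F_5) != 0%R by [].
pose a := perm (@addrI 'F_5 1%R); pose b := perm (mulfI nz2).
have aX k i : (a ^+ k) i = (k%:R + i)%R.
  elim: k i => [|k IHk] i; first by rewrite perm1 add0r.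
  by rewrite expgS permM IHk permE addrA -natr1.
have bX k i : (b ^+ k) i = (2%:R ^+ k * i)%R.
  elim: k i => [|k IHk] i; first by rewrite perm1 mul1r.
  by rewrite expgS permM IHk permE exprSr -mulrA.
have five0 : (5%:R = 0 :> 'F_5)%R by apply/eqP.
have two4 : (2%:R ^+ 4 = 1 :> 'F_5)%R by apply/eqP.
have a5 : a ^+ 5 = 1 by apply/permP=> i; rewrite aX perm1 five0 add0r.
have b4 : b ^+ 4 = 1 by apply/permP=> i; rewrite bX perm1 two4 mul1r.
have ab : a ^ b = a ^+ 2.
  (* The relation is checked as [a * b = b * a ^+ 2]: permutations compose from left to right, and
     both sides send [i] to [2 + 2 i]. *)
  rewrite conjgE; apply: (mulgI b); rewrite mulKVg.
  by apply/permP=> i; rewrite permM [RHS]permM aX !permE mulrDr mulr1.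
exists (<[a]> <*> <[b]>)%G.
  by apply/existsP; exists (a, b); rewrite /= !xpair_eqE a5 b4 ab !eqxx.
have oa : #[a] = 5.
  apply: nt_prime_order => //; apply/eqP=> /permP/(_ 0%R).
  by rewrite permE perm1.
have ob : #[b] = 4.
  apply: (@orderXprime _ 2 2) => //; apply: nt_prime_order => //.
    by rewrite -expgM.
  by apply/eqP=> /permP/(_ 1%R); rewrite bX perm1.
have dvd5 := cardSg (joing_subl <[a]> <[b]>).
have dvd4 := cardSg (joing_subr <[a]> <[b]>).
rewrite -orderE oa in dvd5; rewrite -orderE ob in dvd4.
by rewrite (@Gauss_dvd 5 4) // dvd5.
Qed.

(** The model bounds the order of [H] from below and the relations bound it from above, which fixes
    the orders of both generators. The action is semiregular because 2 has order 4 modulo 5. *)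
Lemma Sz2_Frobenius (gT : finGroupType) (H : {group gT}) :
    is_Sz2 H ->
  exists K L : {group gT},
    [/\ [Frobenius H = K ><| L], cyclic K, cyclic L, #|K| = 5 & #|L| = 4].
Proof.
move=> isoH; have [M homM dvdM] := Sz2_model.
have{dvdM} dvdH : 20 %| #|H|.
  by apply: dvdn_trans dvdM _; apply: card_homg; rewrite isoH.
have /existsP[[a b] /=] := isoGrp_hom isoH.
rewrite !xpair_eqE => /andP[/eqP defH /and3P[/eqP a5 /eqP b4 /eqP ab]].
have nab : <[b]> \subset 'N(<[a]>) by rewrite norms_cycle ab mem_cycle.
rewrite norm_joinEr // in defH.
have oa5 : #[a] %| 5 by rewrite order_dvdn a5.
have ob4 : #[b] %| 4 by rewrite order_dvdn b4.
have [oa ob tiab] : [/\ #[a] = 5, #[b] = 4 & <[a]> :&: <[b]> = 1].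
  (* The product of the two orders is a positive multiple of [#|H|], hence at least 20, while the
     factors are at most 5 and 4; so both bounds are attained. *)
  have := mul_cardG <[a]> <[b]>; rewrite defH => oH.
  have le20 : 20 <= #|<[a]>| * #|<[b]>|.
    rewrite oH; apply: leq_trans (leq_pmulr _ (cardG_gt0 _)).
    exact: dvdn_leq (cardG_gt0 _) dvdH.
  have := dvdn_leq (ltn0Sn 4) oa5; have := dvdn_leq (ltn0Sn 3) ob4.
  rewrite -!orderE in le20 *.
  move=> le4 le5.
  have oa : #[a] = 5 by nia.
  have ob : #[b] = 4 by nia.
  by split=> //; rewrite coprime_TIg // -!orderE oa ob.
exists <[a]>%G, <[b]>%G; split; rewrite -?orderE ?cycle_cyclic //.
apply/Frobenius_semiregularP.
- by rewrite sdprodE.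
- by rewrite cycle_eq1 -order_gt1 oa.
- by rewrite cycle_eq1 -order_gt1 ob.
move=> y /setD1P[nt /cycleP[j def_y]]; rewrite {y}def_y in nt *.
(* As [<[a]>] has prime order, a nontrivial intersection with the centraliser would force [b ^+ j]
   to fix [a], that is, [2 ^ j] to be 1 modulo 5. *)
apply: prime_TIg; first by rewrite -orderE oa.
rewrite cycle_subG; apply: contra nt => /cent1P cab.
have aJ k : a ^ (b ^+ k) = a ^+ (2 ^ k).
  elim: k => [|k IHk]; first by rewrite conjg1.
  by rewrite expgSr conjgM IHk conjXg ab -expgM expnS.
have: a ^ (b ^+ j) = a by rewrite conjgE cab mulKg.
rewrite -(expg_mod j b4) aJ; have: j %% 4 < 4 by rewrite ltn_mod.
case: (j %% 4) => [|[|[|[|//]]]] _ //= /eqP;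
  by rewrite -[X in _ == X]expg1 eq_expg_mod_order oa.
Qed.

(** * Commutation and the Frobenius partition *)

Section FrobeniusBlocks.

Variables (gT : finGroupType) (G K L : {group gT}).
Hypothesis frobG : [Frobenius G = K ><| L].
Hypothesis cycK : cyclic K.
Hypothesis cycL : cyclic L.

Local Notation P := (gval K |: (L^# :^: K)).

(** This treats both kinds of block at once. The kernel contains 1 and the conjugates of [L^#] do
    not, so a block is only pinned between [A^#] and [A]. *)
Lemma Frobenius_block (B : {set gT}) : B \in P ->
  exists2 A : {group gT}, cyclic A &
    [/\ B \subset A, A^# \subset B & {in B^#, forall x, 'C_G[x] \subset A}].
Proof.
case/setU1P=> [->|/imsetP[k Kk ->]].
  by exists K => //; split; [|apply: subD1set|exact: Frobenius_cent1_ker frobG].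
exists (L :^ k)%G; rewrite ?cyclicJ //.
have [defG _ _ /proper_sub sKG _] := Frobenius_context frobG.
have /andP[_ tiL] := FrobeniusWcompl frobG.
rewrite /= conjSg subD1set conjD1g; split=> // x.
rewrite !inE => /and3P[_ ntx Lx].
(* Conjugating back by [k] brings [x] into [L^#], where the trivial intersection property of the
   complement bounds its centraliser. *)
rewrite -(conjGid (subsetP sKG k Kk)) -[x](conjgKV k) cent1J -conjIg conjSg.
apply: (cent1_normedTI tiL).
by rewrite !inE conjg_eq1 ntx -mem_conjg.
Qed.

(** The centraliser of [x] lies in the cyclic group around its block, and [y], being nontrivial
    there, is in the block itself. *)
Lemma Frobenius_commute_pblock :
  {in G^# &, forall x y, commute x y -> pblock P x = pblock P y}.
Proof.
move=> x y /setD1P[ntx Gx] /setD1P[nty Gy] cxy.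
have /and3P[/eqP covP tiP _] := Frobenius_partition frobG.
have Px : x \in pblock P x by rewrite mem_pblock covP.
have PPx : pblock P x \in P by rewrite pblock_mem ?covP.
have [A _ [_ sAB cB]] := Frobenius_block PPx.
apply/esym/(def_pblock tiP PPx); apply: (subsetP sAB); rewrite !inE nty.
have B1x : x \in (pblock P x)^# by rewrite !inE ntx.
by apply: (subsetP (cB x B1x)); rewrite inE Gy; apply/cent1P.
Qed.

Lemma Frobenius_pblock_cyclic x y :
    x \in G -> y \in G -> pblock P x = pblock P y ->
  exists A : {group gT}, [/\ cyclic A, x \in A & y \in A].
Proof.
move=> Gx Gy eqxy; have /and3P[/eqP covP _ _] := Frobenius_partition frobG.
have PPx : pblock P x \in P by rewrite pblock_mem ?covP.
have [A cycA [/subsetP sBA _ _]] := Frobenius_block PPx.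
by exists A; split=> //; apply: sBA; [|rewrite eqxy]; rewrite mem_pblock covP.
Qed.

Lemma Frobenius_ker_notin_conj_compl : gval K \notin L^# :^: K.
Proof.
apply/imsetP=> [[k _ /setP/(_ 1)]].
by rewrite group1 mem_conjg conj1g !inE eqxx.
Qed.

(** Counting the group through the partition, with [k] conjugates, gives
    [#|K| * #|L| = #|K| + k * (#|L| - 1)], and [L] is nontrivial. *)
Lemma card_Frobenius_blocks : #|L^# :^: K| = #|K|.
Proof.
have [/sdprod_card oG _ ntL _ _] := Frobenius_context frobG.
have := card_partition (Frobenius_partition frobG).
rewrite -oG big_setU1 ?Frobenius_ker_notin_conj_compl //=.
rewrite (eq_bigr (fun=> #|L^#|)) => [|_ /imsetP[k _ ->]].
  rewrite sum_nat_const; have := cardsD1 1 L; rewrite group1 /= => ->.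
  have := ntL; rewrite -cardG_gt1 (cardsD1 1 L) group1.
  move: #|_| #|_| #|_| => x y z; nia.
by rewrite cardJg.
Qed.

End FrobeniusBlocks.

(** Each fibre of the coset map is a coset of [H]. The set [D] need not be a group, since blocks
    without the identity are pulled back. *)
Lemma card_cosetpre_set (gT : finGroupType) (H : {group gT})
    (D : {set coset_of H}) :
  #|coset H @*^-1 D| = (#|H| * #|D|)%N.
Proof.
rewrite -sum1_card (partition_big (coset H) (mem D)) => [|x /morphpreP[] //].
rewrite mulnC -sum_nat_const; apply: eq_bigr => d /= Dd.
rewrite sum1dep_card; have [x Nx def_d] := cosetP d.
rewrite -(card_rcoset H x) -cosetpre_set1 // -def_d; apply: eq_card => y.
by rewrite !inE /=; case: eqP => [->|]; rewrite ?Dd !(andbT, andbF).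
Qed.

(** * Parts of the non-commuting graph *)

Section NoncommutingParts.

Variables (gT : finGroupType) (G : {group gT}).
Variables (K L : {group coset_of 'Z(G)}).
Hypothesis frobG : [Frobenius G / 'Z(G) = K ><| L].
Hypothesis cycK : cyclic K.
Hypothesis cycL : cyclic L.

Definition Frobenius_part (x : noncentral G) : {set coset_of 'Z(G)} :=
  pblock (gval K |: (L^# :^: K)) (coset 'Z(G) (val x)).

Lemma coset_noncentral (x : noncentral G) :
  val x \in 'N('Z(G)) /\ coset 'Z(G) (val x) \in (G / 'Z(G))^#.
Proof.
have /setDP[Gx nZx] := valP x.
have Nx := subsetP (normal_norm (center_normal G)) _ Gx.
split=> //; rewrite !inE mem_quotient // andbT.
by apply: contraNneq nZx => /coset_idr->.
Qed.

(* Two elements whose images lie in a common cyclic subgroup of G / Z(G)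
   commute, because a group that is cyclic modulo a central subgroup is abelian. *)
Lemma noncommutingE (x y : noncentral G) :
  noncommuting x y = (Frobenius_part x != Frobenius_part y).
Proof.
have [Nx Gx] := coset_noncentral x; have [Ny Gy] := coset_noncentral y.
have /setDP[Gvx _] := valP x; have /setDP[Gvy _] := valP y.
rewrite /noncommuting; congr (~~ _); apply/eqP/eqP => [cxy | eqxy].
  apply: (Frobenius_commute_pblock frobG cycK cycL Gx Gy).
  by rewrite /commute -!morphM // cxy.
have [/setD1P[_ {}Gx] /setD1P[_ {}Gy]] := (Gx, Gy).
have [A [cycA Ax Ay]] := Frobenius_pblock_cyclic frobG cycK cycL Gx Gy eqxy.
pose M := (G :&: coset 'Z(G) @*^-1 A)%G.
suffices /centsP abM : abelian M.
  by apply: abM; rewrite inE /= ?Gvx ?Gvy mem_morphpre.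
have sZM : 'Z(G) \subset M.
  by rewrite subsetI center_sub -{1}(ker_coset 'Z(G)) kerE morphpreS ?sub1G.
apply: (@cyclic_factor_abelian _ 'Z(G)%G).
  rewrite subsetI sZM centsC (subset_trans (subsetIl _ _)) // centsC.
  exact: subsetIr.
apply: cyclicS cycA; rewrite -[gval A in X in _ \subset X]cosetpreK.
by rewrite quotientS ?subsetIr.
Qed.

(** A noncentral element has nontrivial image, so the part is the full preimage of [B^#]. *)
Lemma card_Frobenius_part (B : {set coset_of 'Z(G)}) :
    B \in gval K |: (L^# :^: K) ->
  #|[set x | Frobenius_part x == B]| = (#|'Z(G)| * #|B^#|)%N.
Proof.
move=> PB; have part := Frobenius_partition frobG.
have /and3P[/eqP covP tiP _] := part.
rewrite -card_cosetpre_set -(card_imset _ val_inj); apply: eq_card => x.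
apply/imsetP/morphpreP => [[v] | [Nx]].
  rewrite inE => /eqP <- ->; have [Nv /setD1P[ntv Gv]] := coset_noncentral v.
  by split=> //; rewrite !inE ntv mem_pblock covP.
rewrite !inE => /andP[ntx Bx].
have Gx : x \in G.
  rewrite -(quotientGK (center_normal G)) mem_morphpre //= -covP.
  by apply/bigcupP; exists B.
have nZx : x \in G :\: 'Z(G).
  by rewrite inE Gx andbT; apply: contra ntx => Zx; rewrite /= coset_id.
exists (Sub x nZx : noncentral G); last by rewrite SubK.
by rewrite inE; apply/eqP; apply: (def_pblock tiP PB); rewrite SubK.
Qed.

(** Colours range over all sets of cosets, so those outside the partition have to be counted as
    empty. *)
Lemma card_Frobenius_part0 (B : {set coset_of 'Z(G)}) :
    B \notin gval K |: (L^# :^: K) ->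
  #|[set x | Frobenius_part x == B]| = 0%N.
Proof.
move=> PB; apply: eq_card0 => x; rewrite inE; apply: contraNF PB => /eqP<-.
have [_ /setD1P[_ Gx]] := coset_noncentral x.
have /and3P[/eqP covP _ _] := Frobenius_partition frobG.
by rewrite pblock_mem ?covP.
Qed.

End NoncommutingParts.

End Sz2.

(** * The two spectra and their energies *)

Lemma sqrtC_ge_nat (C : numClosedFieldType) (k m : nat) :
  (k ^ 2 <= m)%N -> k%:R <= sqrtC (m%:R : C).
Proof.
move=> le_km; rewrite -(ler_pXn2r (n := 2)) ?nnegrE ?ler0n ?sqrtC_ge0 //.
by rewrite sqrtCK -natrX ler_nat.
Qed.

Theorem theorem4p2 (C : numClosedFieldType) (gT : finGroupType)
    (G : {group gT}) (n : nat)
    (hG : is_Sz2 (G / 'Z(G))%g) (hn : n = #|'Z(G)%g|) :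
  (perm_eq (adjacency_spectrum C (noncommuting_graph G))
      (nseq (19 * n - 6) 0 ++ nseq 4 (- (3 * n%:R))
       ++ [:: 2 * n%:R * (3 + 2 * sqrtC 6); 2 * n%:R * (3 - 2 * sqrtC 6)])
   /\ energy C (noncommuting_graph G) = 4 * n%:R * (3 + 2 * sqrtC 6))
  /\
  (perm_eq (signless_laplacian_spectrum C (noncommuting_graph G))
      (nseq (15 * n - 5) (16 * n%:R) ++ nseq (4 * n - 1) (15 * n%:R)
       ++ nseq 4 (13 * n%:R)
       ++ [:: n%:R * (43 + sqrtC 409) / 2; n%:R * (43 - sqrtC 409) / 2])
   /\ signless_laplacian_energy C (noncommuting_graph G)
      = (120 * n%:R ^+ 2 + 177 * n%:R) / 19 + sqrtC 409 * n%:R).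
Proof.
have [K [L [frobG cycK cycL oK oL]]] := Sz2_Frobenius hG.
have n_gt0 : (0 < n)%N by rewrite hn cardG_gt0.
set X := noncommuting_graph G.
pose S : {set {set coset_of 'Z(G)}} := (L^# :^: K)%g.
pose col : vertex X -> {set coset_of 'Z(G)} := Frobenius_part K L.
have adj_col (x y : vertex X) : adj x y = (col x != col y).
  exact: (noncommutingE frobG cycK cycL).
have card1 (A : {group coset_of 'Z(G)}) : #|A^#%g| = #|A|.-1.
  by rewrite (cardsD1 1%g A) group1.
have oS : #|S| = 5%N by rewrite (card_Frobenius_blocks frobG).
have KS : gval K \notin S by apply: Frobenius_ker_notin_conj_compl.
have part_K : #|[set x | col x == gval K]| = (4 * n)%N.
  rewrite (card_Frobenius_part frobG) ?setU11 //.
  by rewrite card1 oK -hn mulnC.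
have part_S B : B \in S -> #|[set x | col x == B]| = (3 * n)%N.
  move=> SB; rewrite (card_Frobenius_part frobG) ?setU1r // mulnC -hn.
  have /imsetP[k _ ->] := SB.
  by rewrite conjD1g setDDl setUid card1 cardJg oL.
have part_rest B : B != gval K -> B \notin S -> #|[set x | col x == B]| = 0%N.
  move=> nBK SB; apply: (card_Frobenius_part0 frobG).
  by rewrite in_setU1 negb_or nBK.
have q_gt0 : (0 < 4 * n)%N by rewrite muln_gt0.
have s_gt0 : (0 < 3 * n)%N by rewrite muln_gt0.
have S_gt0 : (0 < #|S|)%N by rewrite oS.
have spec := eigenvalues_multipartite adj_col KS S_gt0 q_gt0 s_gt0
  part_K part_S part_rest.
have cardV := card_vertex KS part_K part_S part_rest.
have edgesX := double_edges adj_col KS part_K part_S part_rest.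
rewrite oS in spec cardV edgesX.
have ge0n : 0 <= n%:R :> C by rewrite ler0n.
have nz_n : n%:R != 0 :> C by rewrite pnatr_eq0 -lt0n.
have adjP : perm_eq (adjacency_spectrum C X)
    (nseq (19 * n - 6) 0 ++ nseq 4 (- (3 * n%:R))
     ++ [:: 2 * n%:R * (3 + 2 * sqrtC 6); 2 * n%:R * (3 - 2 * sqrtC 6)]).
  have diag0 : adjacency_mx C X =
      diag_mx (\row_(i < #|vertex X|) (fun=> 0) (enum_val i)) + adjacency_mx C X.
    by apply/matrixP=> i j; rewrite !mxE mul0rn add0r.
  rewrite /adjacency_spectrum diag0.
  (* With [a = b = 0], the multiplicities from the large part and the five small ones merge. *)
  have -> : (19 * n - 6 = (4 * n).-1 + 5 * (3 * n).-1)%N by clear -n_gt0; lia.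
  rewrite nseqD -catA -[- (3 * n%:R)]add0r -natrM.
  apply: (spec C _ _ _ _ (fun=> 0)) => x; first by rewrite if_same.
  rewrite !natrM; have := sqrtCK (6 : C); move: (sqrtC 6) => r r2.
  (* Completing the square exhibits the roots [6 n + 4 n r] and [6 n - 4 n r]. *)
  transitivity ((x - 6 * n%:R) ^+ 2 - 16 * n%:R ^+ 2 * r ^+ 2); last by ring.
  by rewrite r2; ring.
have lapP : perm_eq (signless_laplacian_spectrum C X)
    (nseq (15 * n - 5) (16 * n%:R) ++ nseq (4 * n - 1) (15 * n%:R)
     ++ nseq 4 (13 * n%:R)
     ++ [:: n%:R * (43 + sqrtC 409) / 2; n%:R * (43 - sqrtC 409) / 2]).
  have -> : (15 * n - 5 = 5 * (3 * n).-1)%N by clear -n_gt0; lia.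
  have -> : (4 * n - 1 = (4 * n).-1)%N by clear -n_gt0; lia.
  (* Vertices of the part of size [4 n] have degree [15 n] and the others [16 n]; [spec] lists the
     former first. *)
  rewrite perm_sym perm_catCA perm_sym.
  have -> : 13 * n%:R = 16 * n%:R - (3 * n)%:R :> C by rewrite natrM; ring.
  apply: (spec C _ _ _ _ (fun x => (degree x)%:R)) => x.
    rewrite (degree_col adj_col) cardV; case: eqVneq => [->|nK].
      by rewrite part_K -natrM; congr _%:R; clear -n_gt0; lia.
    (* The part of [x] contains [x], so its colour cannot be one of the empty ones. *)
    have Sx : col x \in S.
      apply: contraT => Sx; have := part_rest _ nK Sx.
      by move/eqP; rewrite cards_eq0 => /eqP/setP/(_ x); rewrite !inE eqxx.
    by rewrite part_S // -natrM; congr _%:R; clear -n_gt0; lia.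
  rewrite !natrM; have := sqrtCK (409 : C); move: (sqrtC 409) => r r2.
  transitivity ((x - 43 * n%:R / 2) ^+ 2 - n%:R ^+ 2 * r ^+ 2 / 4).
    by rewrite r2; field.
  by field.
split; split=> //.
  rewrite /energy (perm_big _ adjP) !big_cat !big_cons big_nil !big_nseq.
  rewrite /= !iter_addr_0.
  have le2 : 2 <= sqrtC 6 :> C by apply: (@sqrtC_ge_nat C 2 6).
  have ge0r : 0 <= sqrtC 6 :> C by apply: le_trans le2; rewrite ler0n.
  have -> : `|2 * n%:R * (3 - 2 * sqrtC 6)| = 2 * n%:R * (2 * sqrtC 6 - 3) :> C.
    rewrite -[LHS]normrN -mulrN opprB ger0_norm // !mulr_ge0 ?ler0n // subr_ge0.
    by apply: le_trans (ler_wpM2l _ le2); rewrite ?ler0n // -natrM ler_nat.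
  have -> : `|2 * n%:R * (3 + 2 * sqrtC 6)| = 2 * n%:R * (3 + 2 * sqrtC 6) :> C.
    by rewrite ger0_norm // !(mulr_ge0, addr_ge0) ?ler0n.
  rewrite normr0 mul0rn normrN ger0_norm ?mulr_ge0 ?ler0n //.
  by ring.
rewrite /signless_laplacian_energy edgesX cardV.
have -> : (4 * n * (5 * (3 * n)) + 5 * (3 * n) * (4 * n + 5 * (3 * n) - 3 * n) =
    300 * n ^ 2)%N.
  have -> : (4 * n + 5 * (3 * n) - 3 * n = 16 * n)%N by clear; lia.
  by ring.
have -> : (4 * n + 5 * (3 * n) = 19 * n)%N by clear -n_gt0; lia.
(* The mean degree [300 n / 19] lies between [15 n] and [16 n], so only [16 n] and the larger
   quadratic root exceed it. *)
set m := _ / _; have mE : m = 300 * n%:R / 19.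
  by rewrite /m (natrM _ 300) natrX (natrM _ 19); field.
have dist_ge z c : 0 <= c -> z - m = c -> `|z - m| = c.
  by move=> c_ge0 ->; rewrite ger0_norm.
have dist_le z c : 0 <= c -> m - z = c -> `|z - m| = c.
  by move=> c_ge0 mz; rewrite distrC mz ger0_norm.
(* The bound 12 suffices because [19 * 12 = 228] exceeds 217, which fixes the sign in [d2]. *)
have le12 : 12 <= sqrtC 409 :> C by apply: (@sqrtC_ge_nat C 12 409).
have ge0r : 0 <= sqrtC 409 :> C by apply: le_trans le12; rewrite ler0n.
have d16 : `|16 * n%:R - m| = 4 * n%:R / 19.
  by apply: dist_ge; rewrite ?mE ?divr_ge0 ?mulr_ge0 ?ler0n //; field.
have d15 : `|15 * n%:R - m| = 15 * n%:R / 19.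
  by apply: dist_le; rewrite ?mE ?divr_ge0 ?mulr_ge0 ?ler0n //; field.
have d13 : `|13 * n%:R - m| = 53 * n%:R / 19.
  by apply: dist_le; rewrite ?mE ?divr_ge0 ?mulr_ge0 ?ler0n //; field.
have d1 : `|n%:R * (43 + sqrtC 409) / 2 - m| = n%:R * (217 + 19 * sqrtC 409) / 38.
  apply: dist_ge; last by rewrite mE; field.
  by apply: divr_ge0 (ler0n _ 38); apply: mulr_ge0 => //; rewrite addr_ge0 ?mulr_ge0.
have d2 : `|n%:R * (43 - sqrtC 409) / 2 - m| = n%:R * (19 * sqrtC 409 - 217) / 38.
  apply: dist_le; last by rewrite mE; field.
  rewrite divr_ge0 ?mulr_ge0 ?ler0n // subr_ge0.
  by apply: le_trans (ler_wpM2l _ le12); rewrite ?ler0n // -natrM ler_nat.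
rewrite (perm_big _ lapP) !big_cat !big_cons big_nil !big_nseq /= !iter_addr_0.
rewrite d16 d15 d13 d1 d2 -[_ *+ (15 * n - 5)]mulr_natl -[_ *+ (4 * n - 1)]mulr_natl.
(* Positivity of [n] makes the truncated subtractions exact. *)
have -> : (15 * n - 5)%:R = 15 * n%:R - 5 :> C.
  by rewrite natrB ?(natrM _ 15) //; clear -n_gt0; lia.
have -> : (4 * n - 1)%:R = 4 * n%:R - 1 :> C.
  by rewrite natrB ?(natrM _ 4) //; clear -n_gt0; lia.
by field.
Qed.
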